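(* Let $0 < p < 2$ and suppose that $(\Omega, \mu)$ is a measure space. A non-empty subset $Z$ of $L_{p}(\Omega, \mu)$ has strict $p$-negative type if and only if it does not admit any virtually degenerate simplices.
   Context: All measures are non-trivial and positive. $L_{p}(\Omega,\mu)$ is real or complex, carries the usual (quasi-)norm $\|f\|_p = (\int_\Omega |f|^p\,d\mu)^{1/p}$, and is assumed to be at least two-dimensional. A subset $Z$ of $L_p(\Omega,\mu)$, with $d(x,y)=\|x-y\|_p$ (a quasi-metric when $p<1$), has $p$-negative type if for all finite sets of distinct points $\{z_1,\ldots,z_n\}\subseteq Z$ and all real $\alpha_1,\ldots,\alpha_n$ with $\alpha_1+\cdots+\alpha_n=0$ we have $\sum_{j,i=1}^n d(z_j,z_i)^p\alpha_j\alpha_i\le 0$; it has strict $p$-negative type if moreover this inequality is strict unless $\alpha_1=\cdots=\alpha_n=0$. A signed $(s,t)$-simplex in a set $X$ ($s,t>0$ integers) is a collection of (not necessarily distinct) points $x_{1},\ldots,x_{s},y_{1},\ldots,y_{t}\in X$ together with real numbers $m_{1},\ldots,m_{s},n_{1},\ldots,n_{t}$ satisfying $m_{1}+\cdots+m_{s}=n_{1}+\cdots+n_{t}$; it is denoted $D=[x_{j}(m_{j});y_{i}(n_{i})]_{s,t}$. Let $S(D)=\{x_1,\ldots,x_s\}\cup\{y_1,\ldots,y_t\}$. For $z\in S(D)$ put $\mathbf{m}(z)=\sum_{j:x_j=z}m_j$ and $\mathbf{n}(z)=\sum_{i:y_i=z}n_i$ (empty sums are $0$). $D$ is degenerate if $\mathbf{m}(z)=\mathbf{n}(z)$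 for all $z\in S(D)$. A non-degenerate signed simplex $D=[x_{j}(m_{j});y_{i}(n_{i})]_{s,t}$ in $L_p(\Omega,\mu)$ is virtually degenerate if for $\mu$-almost every $\omega\in\Omega$ the signed simplex $D(\omega)=[x_{j}(\omega)(m_{j});y_{i}(\omega)(n_{i})]_{s,t}$ in the scalar field is degenerate. A subset $Z$ admits a virtually degenerate simplex if there is a virtually degenerate simplex all of whose points lie in $Z$. *)

(* Defs.v *)
From mathcomp Require Import all_boot all_order all_algebra.
From mathcomp Require Import complex.
From mathcomp Require Import all_classical all_reals all_analysis.
Import Order.TTheory GRing.Theory Num.Theory.
Import numFieldTopology.Exports.

Set Implicit Arguments.
Unset Strict Implicit.
Unset Printing Implicit Defensive.

Local Open Scope classical_set_scope.
Local Open Scope ring_scope.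

Variant scalar_field := RealField | ComplexField.

Definition scalars (R : realType) (F : scalar_field) : numFieldType :=
  match F with RealField => R | ComplexField => R[i] end.

(* The norm of the numFieldType R[i] takes its values in R[i]; [normc] is the
   R-valued modulus. *)
Definition modulus (R : realType) (F : scalar_field) : scalars R F -> R :=
  match F return scalars R F -> R with
  | RealField => fun x => `|x|
  | ComplexField => @ComplexField.Normc.normc R
  end.

(* The scalar field with its Borel sigma-algebra (the one generated by the open
   sets of the norm topology). *)
Definition borel_scalar (R : realType) (F : scalar_field) :=
  g_sigma_algebraType (@open (scalars R F)).

Section Lp.
Context {R : realType} (F : scalar_field) {d : measure_display}.
Context {T : measurableType d} (mu : {measure set T -> \bar R}) (p : R).

(* Classes of scalar-valued measurable functions modulo equality mu-almost
   everywhere; the library's Lspace is real-valued and restricted to 1 <= p. *)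
Definition ae_class : Type := {mfun_ mu, T >-> borel_scalar R F}.

(* The values of a chosen representative: all the notions below that use it are
   insensitive to the choice. *)
Definition ev (f : ae_class) : T -> scalars R F := aqEqMfun_to_fun f.

Definition Lp : set ae_class :=
  [set f | finite_norm mu p%:E (fun w => modulus (ev f w))].

(* The Lnorm is finite when f and g are in Lp, so that [fine] loses nothing. *)
Definition Lp_dist (f g : ae_class) : R :=
  fine (Lnorm mu p%:E (EFin \o (fun w => modulus (ev f w - ev g w)))).

Definition Lp_at_least_two_dimensional : Prop :=
  exists f g : ae_class, [/\ Lp f, Lp g &
    forall a b : scalars R F,
      {ae mu, forall w, a * ev f w + b * ev g w = 0} -> a = 0 /\ b = 0].

End Lp.

Arguments Lp {R F d T mu} p.
Arguments Lp_dist {R F d T mu} p f g.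

Section negative_type.
Context {R : realType} {X : Type} (dist : X -> X -> R) (p : R) (Z : set X).

Definition negative_type : Prop :=
  forall (n : nat) (z : 'I_n -> X) (alpha : 'I_n -> R),
    injective z -> (forall i, Z (z i)) -> \sum_(i < n) alpha i = 0 ->
    \sum_(j < n) \sum_(i < n) dist (z j) (z i) `^ p * alpha j * alpha i <= 0.

Definition strict_negative_type : Prop :=
  negative_type /\
  forall (n : nat) (z : 'I_n -> X) (alpha : 'I_n -> R),
    injective z -> (forall i, Z (z i)) -> \sum_(i < n) alpha i = 0 ->
    ~ (forall i, alpha i = 0) ->
    \sum_(j < n) \sum_(i < n) dist (z j) (z i) `^ p * alpha j * alpha i < 0.

End negative_type.

Record signed_simplex (R : realType) (X : Type) := SignedSimplex {
  nx : nat;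
  ny : nat;
  nx_gt0 : (0 < nx)%N;
  ny_gt0 : (0 < ny)%N;
  xpt : 'I_nx -> X;
  ypt : 'I_ny -> X;
  xwt : 'I_nx -> R;
  ywt : 'I_ny -> R;
  balanced : \sum_(j < nx) xwt j = \sum_(i < ny) ywt i
}.

Arguments xpt {R X} s _.
Arguments ypt {R X} s _.
Arguments xwt {R X} s _.
Arguments ywt {R X} s _.

Definition map_simplex (R : realType) (X Y : Type) (h : X -> Y)
    (D : signed_simplex R X) : signed_simplex R Y :=
  SignedSimplex (nx_gt0 D) (ny_gt0 D)
    (fun j => h (xpt D j)) (fun i => h (ypt D i)) (balanced D).

Definition simplex_points (R : realType) (X : Type) (D : signed_simplex R X) :
  set X := range (xpt D) `|` range (ypt D).

Section degenerate.
Context {R : realType} {X : eqType} (D : signed_simplex R X).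

Definition xmass (z : X) : R := \sum_(j < nx D | xpt D j == z) xwt D j.
Definition ymass (z : X) : R := \sum_(i < ny D | ypt D i == z) ywt D i.

Definition degenerate : Prop :=
  forall z, simplex_points D z -> xmass z = ymass z.

End degenerate.

Section virtually_degenerate.
Context {R : realType} (F : scalar_field) {d : measure_display}.
Context {T : measurableType d} (mu : {measure set T -> \bar R}).

Definition virtually_degenerate (D : signed_simplex R (ae_class F mu)) : Prop :=
  ~ degenerate D /\
  {ae mu, forall w, degenerate (map_simplex (fun f => ev f w) D)}.

Definition admits_virtually_degenerate (Z : set (ae_class F mu)) : Prop :=
  exists D : signed_simplex R (ae_class F mu),
    simplex_points D `<=` Z /\ virtually_degenerate D.

End virtually_degenerate.

(* Main.v *)
(** For real (or complex) scalars and [0 < p < 2], the quadratic form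
    [Q(z, alpha) = sum_(j, i) |z_j - z_i|^p alpha_j alpha_i] with
    [sum alpha = 0] is nonpositive, and vanishes only when the weights
    [alpha_i] attached to each scalar value add up to [0].  Indeed, with
    [t_ji = |z_j - z_i|^2] and [a = p / 2], the function
    [H r = sum_(j, i) (t_ji + r)^a alpha_j alpha_i] tends to [0] at infinity
    and has derivative [a * sum_(j, i) (t_ji + r)^(a - 1) alpha_j alpha_i], which
    is nonnegative because [(t + r)^(- b)] is a positive definite kernel:
    up to a rank one factor it is [(1 - <v_j, v_i>)^(- b)] for suitable vectors
    [v_i] of norm less than [1], and the binomial series has positive
    coefficients.  Hence [Q = H 0 <= 0], and equality forces the moments of all
    orders of the weighted points [v_i] to vanish.
    In [L_p], the form [sum_(j, i) d(z_j, z_i)^p alpha_j alpha_i] is the integral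
    over [w] of the scalar forms [Q(z(w), alpha)], so it vanishes exactly when
    the scalar simplices are degenerate almost everywhere. *)
Require Import Defs.
From mathcomp Require Import all_boot all_order all_algebra.
From mathcomp Require Import complex.
From mathcomp Require Import all_classical all_reals all_analysis.
From mathcomp Require Import measurable_realfun.
From mathcomp Require Import ring lra.
Set Implicit Arguments.
Unset Strict Implicit.
Unset Printing Implicit Defensive.
Import Order.TTheory GRing.Theory Num.Theory.
Import numFieldNormedType.Exports.
Local Open Scope classical_set_scope.
Local Open Scope ring_scope.

(** * Binomial series *)

(** The left-hand side is one term of the binomial expansion of the right. For [e > 0], dividing by
    [e] bounds the terms of a differentiated power series by those of the original one at a larger
    radius. *)
Lemma exprDn_ge_deriv (R : realFieldType) (a e : R) (n : nat) :
  0 <= a -> 0 <= e -> n.+1%:R * a ^+ n * e <= (a + e) ^+ n.+1.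
Proof.
move=> a0 e0; elim: n => [|n IH]; first by rewrite expr0 !mul1r expr1; lra.
have h1 := ler_wpM2l a0 IH.
have h2 : e * a ^+ n.+1 <= e * (a + e) ^+ n.+1.
  by rewrite ler_wpM2l// lerXn2r ?nnegrE ?addr_ge0// lerDl.
have -> : (a + e) ^+ n.+2 = a * (a + e) ^+ n.+1 + e * (a + e) ^+ n.+1.
  by rewrite [LHS]exprS mulrDl.
apply: le_trans (lerD h1 h2); rewrite -natr1 exprS; lra.
Qed.

Lemma is_cvg_pseries_diffs (R : realType) (f : R^nat) (x z : R) :
  cvgn (pseries f x) -> `|z| < `|x| -> cvgn (pseries (pseries_diffs f) z).
Proof.
move=> cfx zx.
pose e : R := (`|x| - `|z|) / 2.
have e0 : 0 < e by rewrite divr_gt0// subr_gt0.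
have yx : `| `|z| + e | < `|x|.
  by rewrite ger0_norm ?addr_ge0 ?(ltW e0)// /e; lra.
have := is_cvg_pseries_inside_norm cfx yx.
set g := fun i => `|f i| * (`|z| + e) ^+ i.
have -> : pseries (fun i => `|f i|) (`|z| + e) = series g by [].
move=> cg0.
have /(is_cvg_seriesZ (k := e^-1)) cg : cvgn (series (fun i => g i.+1)).
  have -> : series (fun i => g i.+1) = (fun n => series g n.+1 - g 0%N).
    by apply/funext => n; rewrite /series/= big_nat_recl// addrC addKr.
  apply: (cvgP (limn (series g) - g 0%N)); apply: cvgB; last exact: cvg_cst.
  by rewrite (cvg_shiftS (series g)).
apply: normed_cvg; apply: series_le_cvg cg => [i|i|i]; first exact: normr_ge0.
  rewrite /= mulr_ge0 ?invr_ge0 ?(ltW e0)// mulr_ge0//.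
  by rewrite exprn_ge0// addr_ge0// ltW.
rewrite -[leLHS]/(`|i.+1%:R * f i.+1 * z ^+ i|) !normrM normr_nat normrX.
rewrite -[leRHS]/(e^-1 * (`|f i.+1| * _)) ler_pdivlMl//.
have := ler_wpM2l (normr_ge0 (f i.+1)) (exprDn_ge_deriv i (normr_ge0 z) (ltW e0)).
by apply: le_trans; rewrite le_eqVlt; apply/orP; left; apply/eqP; ring.
Qed.

Section binomial_series.
Context {R : realType}.
(** The coefficient of [x^k] in the expansion of [(1 - x)^(- b)], that is
    [b (b + 1) ... (b + k - 1) / k!]. *)
Definition neg_binomial (b : R) (k : nat) : R :=
  \prod_(j < k) ((b + j%:R) / j.+1%:R).

Lemma neg_binomial0 b : neg_binomial b 0 = 1.
Proof. by rewrite /neg_binomial big_ord0. Qed.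

Lemma neg_binomial_gt0 b k : 0 < b -> 0 < neg_binomial b k.
Proof.
move=> b0; apply: prodr_gt0 => j _.
by rewrite divr_gt0// ltr_wpDr.
Qed.

Lemma neg_binomial_le1 b k : 0 < b <= 1 -> neg_binomial b k <= 1.
Proof.
move=> /andP[b0 b1]; rewrite -[leRHS](expr1n _ k) -[X in _ ^+ X]card_ord.
rewrite -prodr_const; apply: ler_prod => j _.
by rewrite divr_ge0 ?addr_ge0 ?(ltW b0)//= ler_pdivrMr// mul1r -nat1r lerD2r.
Qed.

Lemma pseries_diffs_neg_binomial b k :
  pseries_diffs (neg_binomial b) k = (b + k%:R) * neg_binomial b k.
Proof. by rewrite /pseries_diffs /neg_binomial big_ord_recr/=; field. Qed.

Lemma is_cvg_pseries_neg_binomial (b x : R) : 0 < b <= 1 -> `|x| < 1 ->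
  cvgn (pseries (neg_binomial b) x).
Proof.
move=> b01 x1; have /andP[b0 b1] := b01.
apply: normed_cvg; apply: (@series_le_cvg _ _ (geometric 1 `|x|)) => [i|i|i|].
- exact: normr_ge0.
- by rewrite /= mul1r exprn_ge0.
- rewrite -[leLHS]/(`|neg_binomial b i * x ^+ i|) normrM normrX.
  rewrite ler_wpM2r ?exprn_ge0// ger0_norm ?neg_binomial_le1//.
  exact/ltW/neg_binomial_gt0.
- by apply: is_cvg_geometric_series; rewrite normr_id.
Qed.

Let S (b x : R) : R := limn (pseries (neg_binomial b) x).
Let S' (b x : R) : R := limn (pseries (pseries_diffs (neg_binomial b)) x).

Let midpoint_lt1 (x : R) : `|x| < 1 -> {y : R | `|x| < `|y| & `|y| < 1}.
Proof.
move=> x1; exists ((1 + `|x|) / 2).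
  rewrite [ltRHS]ger0_norm ?divr_ge0 ?addr_ge0//.
  by rewrite ltr_pdivlMr//; lra.
by rewrite ger0_norm ?divr_ge0 ?addr_ge0//; lra.
Qed.

Let is_derive_S (b x : R) : 0 < b <= 1 -> `|x| < 1 -> is_derive x 1 (S b) (S' b x).
Proof.
move=> b01 x1.
(* Each termwise differentiation costs some radius: the second derived series is needed at [y], the
   first at [z] and the series itself at [w]. *)
have [y xy y1] := midpoint_lt1 x1.
have [z yz z1] := midpoint_lt1 y1.
have [w zw w1] := midpoint_lt1 z1.
have cz := is_cvg_pseries_diffs (is_cvg_pseries_neg_binomial b01 w1) zw.
apply: (@pseries_snd_diffs _ _ y) => //.
- exact: is_cvg_pseries_neg_binomial.
- exact: is_cvg_pseries_diffs (is_cvg_pseries_neg_binomial b01 z1) yz.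
- exact: is_cvg_pseries_diffs cz yz.
Qed.

(** The coefficients satisfy [(k + 1) c_(k+1) = (b + k) c_k], so [S' = b S + x S']. *)
Let S_ode (b x : R) : 0 < b <= 1 -> `|x| < 1 -> (1 - x) * S' b x = b * S b x.
Proof.
move=> b01 x1.
have [y xy y1] := midpoint_lt1 x1.
have cf := is_cvg_pseries_neg_binomial b01 x1.
have cd := is_cvg_pseries_diffs (is_cvg_pseries_neg_binomial b01 y1) xy.
have e1 := cvgM (cvg_cst x) (pseries_diffs_equiv cd).
have e2 := cvgM (cvg_cst b) cf.
suff : S' b x = b * S b x + x * S' b x by rewrite mulrBl mul1r => {1}->; rewrite addrK.
apply/cvg_lim => //.
rewrite (_ : pseries (pseries_diffs _) x = (fun n =>
    b * pseries (neg_binomial b) x n +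
    x * series (fun i => i%:R * neg_binomial b i * x ^+ i.-1) n)).
  exact: cvgD (e2 _ _) (e1 _ _).
apply/funext => n; rewrite /pseries /series /= !mulr_sumr -big_split/=.
apply: eq_bigr => i _.
rewrite pseries_diffs_neg_binomial.
by case: i => [|i]/=; rewrite ?exprS; ring.
Qed.

Lemma cvg_pseries_neg_binomial (b x : R) : 0 < b <= 1 -> `|x| < 1 ->
  pseries (neg_binomial b) x @ \oo --> (1 - x) `^ (- b).
Proof.
move=> b01 x1; suff <- : S b x = (1 - x) `^ (- b) by exact: is_cvg_pseries_neg_binomial.
have sx1 (s : R) : 0 <= s -> s <= 1 -> `|s * x| < 1.
  move=> s0 s1; rewrite normrM (ger0_norm s0) (le_lt_trans _ x1)//.
  by rewrite ler_piMl.
have sx0 (s : R) : 0 <= s -> s <= 1 -> 0 < 1 - s * x.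
  by move=> s0 s1; rewrite subr_gt0 (le_lt_trans (ler_norm _))// sx1.
have dA (s : R) : is_derive s 1 (fun s : R => s * x) x.
  have -> : (fun s : R => s * x) = x *: (id : R -> R) by apply/funext => t; rewrite /= mulrC.
  by apply: is_derive_eq; rewrite /GRing.scale/= mulr1.
(* By the differential equation [G] is constant on [[0, 1]]; comparing [G 1] with [G 0 = 1]
   identifies [S b x]. *)
pose G s := S b (s * x) * (1 - s * x) `^ b.
have dG (s : R) : 0 <= s -> s <= 1 -> is_derive s 1 G 0.
  move=> s0 s1.
  have dS : is_derive s 1 (fun s : R => S b (s * x)) (x * S' b (s * x)).
    rewrite mulrC; apply: (@is_derive1_comp _ (S b) (fun s : R => s * x)) => //.
    exact: is_derive_S (sx1 _ s0 s1).
  have dB : is_derive s 1 (fun s : R => 1 - s * x) (- x).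
    have := is_deriveB (is_derive_cst (1 : R) s 1) (dA s).
    by rewrite sub0r.
  have dP : is_derive s 1 (fun s : R => (1 - s * x) `^ b) (- x * (b * (1 - s * x) `^ (b - 1))).
    rewrite [- x * _]mulrC.
    exact: (@is_derive1_comp _ (@powR R ^~ b) (fun s : R => 1 - s * x) s _ _
      (is_derive1_powR b (sx0 _ s0 s1)) dB).
  apply: (is_derive_eq (is_deriveM dS dP)); rewrite /GRing.scale/=.
  have p0 := sx0 _ s0 s1.
  have bgt0 : 0 < b by case/andP: b01.
  rewrite -[(1 - s * x) `^ b](mulr_powRB1 (ltW p0) bgt0).
  set P := _ `^ (b - 1).
  transitivity (x * P * ((1 - s * x) * S' b (s * x) - b * S b (s * x))); first ring.
  by rewrite S_ode ?sx1 ?subrr ?mulr0.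
have [s||c _] := @MVT _ G (cst 0) 0 1 ltr01.
- by rewrite in_itv/= => /andP[/ltW ? /ltW ?]; exact: dG.
- by apply: derivable_within_continuous => s; rewrite in_itv/= => /andP[? ?]; apply: ex_derive; exact: dG.
rewrite mul0r /G !mul0r subr0 powR1 mulr1 !mul1r => /eqP; rewrite subr_eq0 => /eqP.
have -> : S b 0 = 1.
  apply/cvg_lim => //; apply: cvg_near_cst; near=> n.
  rewrite /pseries /series /= -(@prednK n); last by near: n; exact: nbhs_infty_gt.
  rewrite big_nat_recl//= expr0 mulr1 neg_binomial0 big1 ?addr0// => i _.
  by rewrite exprS mul0r mulr0.
move=> h; rewrite powRN -[RHS]mul1r -[X in X / _]h mulfK// gt_eqF// powR_gt0//.
by have := sx0 1; rewrite mul1r; apply.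
Unshelve. all: by end_near. Qed.
End binomial_series.

(** * Positive definite kernels *)

Section dot_kernel.
Context {R : realFieldType} {I C : finType}.
Implicit Types (v : I -> C -> R) (beta : I -> R).

(** The [k]-th power of an inner product is the inner product of [k]-fold tensor powers, whose
    coordinates are indexed by the maps [f]; the form is then a squared norm. *)
Lemma dot_pow_quadratic_form v beta k :
  \sum_j \sum_i (\sum_c v j c * v i c) ^+ k * beta j * beta i =
  \sum_(f : {ffun 'I_k -> C}) (\sum_i beta i * \prod_l v i (f l)) ^+ 2.
Proof.
transitivity (\sum_j \sum_i \sum_(f : {ffun 'I_k -> C})
   (beta j * \prod_l v j (f l)) * (beta i * \prod_l v i (f l))).
  apply: eq_bigr => j _; apply: eq_bigr => i _.
  rewrite -[X in _ ^+ X]card_ord -prodr_const bigA_distr_bigA/= !mulr_suml.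
  by apply: eq_bigr => f _; rewrite big_split/=; ring.
under eq_bigr do rewrite exchange_big/=.
rewrite exchange_big/=; apply: eq_bigr => f _.
by rewrite expr2 big_distrlr.
Qed.

Lemma dot_pow_quadratic_form_ge0 v beta k :
  0 <= \sum_j \sum_i (\sum_c v j c * v i c) ^+ k * beta j * beta i.
Proof. by rewrite dot_pow_quadratic_form sumr_ge0// => f _; exact: sqr_ge0. Qed.

(** Each square in the decomposition vanishes; taking [k = size s] and letting [f] list the entries
    of [s] isolates the moment of [s]. *)
Lemma dot_pow_moment0 v beta :
  (forall k, \sum_j \sum_i (\sum_c v j c * v i c) ^+ k * beta j * beta i = 0) ->
  forall s : seq C, \sum_i beta i * \prod_(c <- s) v i c = 0.
Proof.
move=> h s; have /eqP := h (size s); rewrite dot_pow_quadratic_form psumr_eq0.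
  move=> /allP/(_ [ffun l => tnth (in_tuple s) l]); rewrite mem_index_enum => /(_ isT)/=.
  rewrite sqrf_eq0 => /eqP h0; rewrite -[RHS]h0; apply: eq_bigr => i _.
  by rewrite [in LHS]big_tnth; congr (_ * _); apply: eq_bigr => l _; rewrite ffunE.
by move=> f _; exact: sqr_ge0.
Qed.

(** Weights whose monomial moments all vanish annihilate every polynomial, and polynomials separate
    finitely many points. *)
Lemma moment0_fiber v beta (i0 : I) :
  (forall s : seq C, \sum_i beta i * \prod_(c <- s) v i c = 0) ->
  \sum_(i | [forall c, v i c == v i0 c]) beta i = 0.
Proof.
move=> h.
(* A product of affine functions, vanishing at the points [v j] other than
   [v i0] but not at [v i0]. *)
pose q (js : seq I) i := \prod_(j <- js) \sum_c (v j c - v i0 c) * (v j c - v i c).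
(* Each affine factor of [q] is split into a constant and multiples of the coordinates, and the
   coordinates are absorbed into the arbitrary monomial [s]. *)
have hq js : forall s : seq C, \sum_i beta i * q js i * \prod_(c <- s) v i c = 0.
  elim: js => [|j js IH] s.
    by rewrite -[RHS](h s); apply: eq_bigr => i _; rewrite /q big_nil mulr1.
  transitivity (\sum_i ((\sum_c (v j c - v i0 c) * v j c) *
      (beta i * q js i * \prod_(c <- s) v i c)
    - \sum_c (v j c - v i0 c) * (beta i * q js i * \prod_(c' <- c :: s) v i c'))).
    apply: eq_bigr => i _; transitivity
        ((\sum_c (v j c - v i0 c) * (v j c - v i c)) *
         (beta i * q js i * \prod_(c <- s) v i c)).
      by rewrite /q big_cons; ring.
    rewrite !mulr_suml -sumrB.
    by apply: eq_bigr => c _; rewrite big_cons; ring.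
  rewrite sumrB -mulr_sumr IH mulr0 exchange_big/= big1 ?subrr// => c _.
  by rewrite -mulr_sumr IH mulr0.
pose js := [seq j <- enum I | ~~ [forall c, v j c == v i0 c]].
have := hq js [::]; under eq_bigr do rewrite big_nil mulr1.
rewrite (bigID (fun i => [forall c, v i c == v i0 c]))/= [X in _ + X]big1; last first.
  move=> i hi; have ijs : i \in js by rewrite mem_filter hi mem_enum.
  rewrite /q (big_rem i ijs)/=; move: (rem i js) => js'.
  by rewrite big1 ?mul0r ?mulr0// => c _; rewrite subrr mulr0.
rewrite addr0 (eq_bigr (fun i => beta i * q js i0)); last first.
  move=> i /forallP hi; congr (_ * _); apply: eq_bigr => j _.
  by apply: eq_bigr => c _; rewrite (eqP (hi c)).
rewrite -mulr_suml => /eqP; rewrite mulf_eq0 => /orP[/eqP//|].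
(* [q js i0] is nonzero: its factors are the squared distances from [v i0] to points different from
   it. *)
rewrite prodf_seq_eq0 => /hasP[j]; rewrite mem_filter => /andP[/forallPn[c hc] _] /=.
rewrite psumr_eq0 => [/allP/(_ c)|c' _]; last by rewrite -expr2 sqr_ge0.
by rewrite mem_index_enum => /(_ isT)/=; rewrite -expr2 sqrf_eq0 subr_eq0 (negbTE hc).
Qed.

End dot_kernel.

(** * The kernel [(1 - <v_j, v_i>)^(- b)] *)

Section neg_binomial_kernel.
Context {R : realType} {I C : finType}.
Variables (v : I -> C -> R) (beta : I -> R) (b : R).
Hypothesis b01 : 0 < b <= 1.
Hypothesis v1 : forall i, \sum_c v i c ^+ 2 < 1.

Let K j i := \sum_c v j c * v i c.
Let P k := \sum_j \sum_i K j i ^+ k * beta j * beta i.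

Let K_lt1 j i : `|K j i| < 1.
Proof.
have v2 : \sum_c v j c ^+ 2 + \sum_c v i c ^+ 2 < 1 + 1 by rewrite ltrD.
have h1 : 0 <= \sum_c v j c ^+ 2 + \sum_c v i c ^+ 2 - 2 * K j i.
  rewrite mulr_sumr -big_split -sumrB/= sumr_ge0// => c _.
  by have := sqr_ge0 (v j c - v i c); rewrite sqrrB; lra.
have h2 : 0 <= \sum_c v j c ^+ 2 + \sum_c v i c ^+ 2 + 2 * K j i.
  rewrite mulr_sumr -!big_split/= sumr_ge0// => c _.
  by have := sqr_ge0 (v j c + v i c); rewrite sqrrD; lra.
by rewrite ltr_norml; apply/andP; split; lra.
Qed.

Let Q := \sum_j \sum_i (1 - K j i) `^ (- b) * beta j * beta i.

Let cvg_Q : series (fun k => neg_binomial b k * P k) @ \oo --> Q.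
Proof.
have -> : series (fun k => neg_binomial b k * P k) = (fun n =>
    \sum_j \sum_i pseries (neg_binomial b) (K j i) n * beta j * beta i).
  apply/funext => n; rewrite /series/= /P.
  under eq_bigr do rewrite mulr_sumr.
  rewrite exchange_big/=; apply: eq_bigr => j _.
  under eq_bigr do rewrite mulr_sumr.
  rewrite exchange_big/=; apply: eq_bigr => i _.
  by rewrite /pseries/series/= !mulr_suml; apply: eq_bigr => k _; ring.
apply: (cvg_big add_continuous) => j _.
apply: (cvg_big add_continuous) => i _.
by apply: cvgMr_tmp; apply: cvgMr_tmp; exact: cvg_pseries_neg_binomial.
Qed.

(** [Q] is the limit of a series with nonnegative terms, so it dominates each of them. Hence [Q = 0]
    makes every [P k] vanish, the coefficients being positive. *)
Let term_le_Q k : 0 <= neg_binomial b k * P k <= Q.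
Proof.
have [b0 _] := andP b01.
have t0 i : 0 <= neg_binomial b i * P i.
  by rewrite mulr_ge0 ?dot_pow_quadratic_form_ge0// ltW// neg_binomial_gt0.
rewrite t0/= -(cvg_lim _ cvg_Q)//.
have nd : nondecreasing_seq (series (fun k => neg_binomial b k * P k)).
  by apply/nondecreasing_seqP => n; rewrite seriesSr lerDl.
apply: le_trans (nondecreasing_cvgn_le nd (cvgP _ cvg_Q) k.+1).
by rewrite seriesSr lerDr sumr_ge0.
Qed.

Lemma neg_binomial_kernel_ge0 : 0 <= Q.
Proof. by have /andP[/le_trans + h] := term_le_Q 0; apply. Qed.

Lemma neg_binomial_kernel_eq0 i0 : Q = 0 ->
  \sum_(i | [forall c, v i c == v i0 c]) beta i = 0.
Proof.
move=> Q0; apply: moment0_fiber; apply: dot_pow_moment0 => k.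
have := term_le_Q k; rewrite Q0 => /le_anti/esym/eqP; rewrite mulf_eq0.
have [b0 _] := andP b01.
by rewrite gt_eqF ?neg_binomial_gt0//= => /eqP.
Qed.

End neg_binomial_kernel.

(** * The kernel [(|x_j - x_i|^2 + r)^(- b)] *)

Section shifted_kernel.
Context {R : realType} {n m : nat}.
Variables (x : 'I_n -> 'I_m -> R) (alpha : 'I_n -> R).

Let t j i := \sum_c (x j c - x i c) ^+ 2.
Let fiber i0 i := [forall c, x i c == x i0 c].

Let t_ge0 j i : 0 <= t j i.
Proof. by rewrite sumr_ge0// => c _; exact: sqr_ge0. Qed.

Section shift.
Variables (b r : R).
Hypotheses (b01 : 0 < b <= 1) (r0 : 0 < r).

Let h i := \sum_c x i c ^+ 2 + r / 2.

(* The formula comes from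
   [t j i + r = h j + h i - 2 * \sum_c x j c * x i c] and
   [2 * (h j + h i) = (h j + 1) * (h i + 1) - (h j - 1) * (h i - 1)]. *)
Let v i (k : 'I_m.+1) : R :=
  if unlift ord0 k is Some c then 2 * x i c / (h i + 1) else (h i - 1) / (h i + 1).

Let h1_gt0 i : 0 < h i + 1.
Proof.
have xi0 : 0 <= \sum_c x i c ^+ 2 by rewrite sumr_ge0// => c _; exact: sqr_ge0.
by rewrite addr_gt0// ltr_wpDl// divr_gt0.
Qed.

Let v_dot j i :
  \sum_k v j k * v i k = 1 - 2 * (t j i + r) / ((h j + 1) * (h i + 1)).
Proof.
have tE : t j i = \sum_c x j c ^+ 2 + \sum_c x i c ^+ 2 - 2 * \sum_c x j c * x i c.
  rewrite mulr_sumr -big_split -sumrB; apply: eq_bigr => c _ /=; ring.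
rewrite big_ord_recl /v unlift_none.
rewrite (eq_bigr (fun c => 4 / ((h j + 1) * (h i + 1)) * (x j c * x i c))); last first.
  by move=> c _; rewrite liftK; field; rewrite !gt_eqF.
rewrite -mulr_sumr tE.
have -> : \sum_c x j c ^+ 2 = h j - r / 2 by rewrite /h addrK.
have -> : \sum_c x i c ^+ 2 = h i - r / 2 by rewrite /h addrK.
by field; rewrite !gt_eqF.
Qed.

(** On the diagonal [t i i = 0], so [v_dot] gives [1 - 2 r / (h i + 1)^2], and [r > 0]. *)
Let v_lt1 i : \sum_k v i k ^+ 2 < 1.
Proof.
under eq_bigr do rewrite expr2.
rewrite v_dot /t big1 => [|c _]; last by rewrite subrr expr0n.
by rewrite add0r gtrBl divr_gt0 ?mulr_gt0.
Qed.

(** The coordinate [(h i - 1) / (h i + 1)] determines [h i], after which the remaining ones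
    determine [x i]. *)
Let fiberE i0 i : [forall k, v i k == v i0 k] = fiber i0 i.
Proof.
apply/forallP/forallP => [vE c|xE k].
  have hE : h i = h i0.
    have := vE ord0; rewrite /v unlift_none.
    rewrite (eqr_div _ _ (lt0r_neq0 (h1_gt0 i)) (lt0r_neq0 (h1_gt0 i0))).
    by move=> /eqP hE; lra.
  have /eqP := vE (lift ord0 c); rewrite /v liftK hE => /(mulIf _) e.
  apply/eqP/(@mulfI _ (2 : R)) => //; apply: e.
  by rewrite invr_eq0 gt_eqF.
have hE : h i = h i0.
  by rewrite /h; congr (_ + _); apply: eq_bigr => c _; rewrite (eqP (xE c)).
by rewrite /v hE; case: unliftP => [c _|_] //; rewrite (eqP (xE c)).
Qed.

Let Q := \sum_j \sum_i (t j i + r) `^ (- b) * alpha j * alpha i.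
Let beta i := alpha i * (h i + 1) `^ (- b).

(** Solving [v_dot] for [t j i + r] gives [(h j + 1) (h i + 1) / 2] times [1 - <v_j, v_i>]; the
    factors depending on [j] or [i] alone go into [beta]. *)
Let QE : Q = 2^-1 `^ (- b) *
  \sum_j \sum_i (1 - \sum_k v j k * v i k) `^ (- b) * beta j * beta i.
Proof.
rewrite mulr_sumr; apply: eq_bigr => j _; rewrite mulr_sumr; apply: eq_bigr => i _.
rewrite v_dot subKr.
set X := 2 * (t j i + r) / _.
have X0 : 0 <= X.
  have tr0 : 0 <= t j i + r := addr_ge0 (t_ge0 j i) (ltW r0).
  by rewrite divr_ge0 ?mulr_ge0 ?(ltW (h1_gt0 _)).
have -> : t j i + r = 2^-1 * (X * ((h j + 1) * (h i + 1))).
  by rewrite /X; field; rewrite !gt_eqF.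
have hh0 : 0 <= (h j + 1) * (h i + 1) by rewrite mulr_ge0// ltW.
rewrite powRM ?invr_ge0 ?(mulr_ge0 X0)// (powRM _ X0 hh0) powRM ?(ltW (h1_gt0 _))//.
by rewrite /beta; ring.
Qed.

Lemma shifted_kernel_ge0 : 0 <= Q.
Proof. by rewrite QE mulr_ge0 ?powR_ge0// neg_binomial_kernel_ge0. Qed.

(** [h] is constant on a fiber, so the factor turning [alpha] into [beta] is common there, and it is
    positive. *)
Lemma shifted_kernel_eq0 i0 : Q = 0 -> \sum_(i | fiber i0 i) alpha i = 0.
Proof.
move/eqP; rewrite QE mulf_eq0 gt_eqF ?powR_gt0 ?invr_gt0//= => /eqP.
move/(neg_binomial_kernel_eq0 b01 v_lt1) => /(_ i0).
rewrite (eq_bigl _ _ (fiberE i0)).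
rewrite (eq_bigr (fun i => alpha i * (h i0 + 1) `^ (- b))).
  rewrite -mulr_suml => /eqP.
  by rewrite mulf_eq0 [X in _ || X]gt_eqF ?powR_gt0// orbF => /eqP.
move=> i /forallP xE; congr (_ * (_ + _) `^ _).
by rewrite /h; congr (_ + _); apply: eq_bigr => c _; rewrite (eqP (xE c)).
Qed.

End shift.

(** * Negativity of the form with entries [|x_j - x_i|^(2 a)] *)

Section negative.
Variable a : R.
Hypotheses (a0 : 0 < a) (a1 : a < 1) (alpha0 : \sum_i alpha i = 0).

Let H r := \sum_j \sum_i (t j i + r) `^ a * alpha j * alpha i.
Let dH r := a * \sum_j \sum_i (t j i + r) `^ (- (1 - a)) * alpha j * alpha i.

Let b01 : 0 < 1 - a <= 1. Proof. by rewrite subr_gt0 a1 gerBl ltW. Qed.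

Let is_derive_H (r : R) : 0 < r -> is_derive r 1 H (dH r).
Proof.
move=> r0.
have -> : H = \sum_j \sum_i (fun r : R => (t j i + r) `^ a * alpha j * alpha i).
  by apply/funext => s; rewrite /H fct_sumE; apply: eq_bigr => j _; rewrite fct_sumE.
rewrite /dH mulr_sumr; apply: is_derive_sum => j.
rewrite mulr_sumr; apply: is_derive_sum => i.
have tr0 : 0 < t j i + r by rewrite ltr_wpDl.
have dA : is_derive r 1 (fun r : R => t j i + r) 1.
  have := is_deriveD (is_derive_cst (t j i : R) r 1) (is_derive_id r (1 : R)).
  by rewrite add0r.
have dP := @is_derive1_comp _ (@powR R ^~ a) (fun r : R => t j i + r) r _ _
      (is_derive1_powR a tr0) dA.
have -> : (fun r : R => (t j i + r) `^ a * alpha j * alpha i) =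
    (alpha j * alpha i) \*: ((@powR R ^~ a) \o (fun r : R => t j i + r)).
  by apply/funext => s; rewrite /= /GRing.scale/=; ring.
by apply: (is_derive_eq (is_deriveZ _ dP)); rewrite /GRing.scale/= opprB; ring.
Qed.

Let cvg_H0 : H r @[r --> 0^'+] --> H 0.
Proof.
apply: (cvg_big add_continuous) => j _; apply: (cvg_big add_continuous) => i _.
apply: cvgMr_tmp; apply: cvgMr_tmp.
(* An entry with [t j i = 0] is [r^a], which tends to [0] from the right since [a > 0]; for the
   other entries the power is differentiable at [t j i]. *)
have := t_ge0 j i; rewrite le_eqVlt => /orP[/eqP <-|tgt0].
  rewrite addr0 powR0 ?gt_eqF//; under eq_cvg do rewrite add0r.
  exact: powR_cvg0.
have -> : (t j i + 0) `^ a = (fun r : R => (t j i + r) `^ a) 0 by [].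
apply: cvg_at_right_filter.
apply: (@continuous_comp _ _ _ (fun r => t j i + r) (@powR R ^~ a)).
  by apply: cvgD; [exact: cvg_cst|exact: cvg_id].
apply/differentiable_continuous/derivable1_diffP.
by apply: derivable_powR; rewrite in_itv/= andbT addr0.
Qed.

Let H_le (r s : R) : 0 < r -> r <= s -> H r <= H s.
Proof.
move=> r0 rs.
have [y||c] := @MVT_segment _ H dH r s rs.
- by rewrite in_itv/= => /andP[ry _]; apply: is_derive_H; exact: lt_trans ry.
- apply: derivable_within_continuous => y; rewrite in_itv/= => /andP[ry _].
  by apply: ex_derive; apply: is_derive_H; exact: lt_le_trans ry.
rewrite in_itv/= => /andP[rc _] /eqP; rewrite subr_eq => /eqP ->.
have c0 := lt_le_trans r0 rc.
by rewrite lerDr mulr_ge0 ?subr_ge0// mulr_ge0 ?(ltW a0)// shifted_kernel_ge0.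
Qed.

(** As the weights sum to [0], [r^a] may be subtracted from every entry, and
    [0 <= (t + r)^a - r^a <= t r^(a - 1)] since [1 <= (1 + t / r)^a <= 1 + t / r]. *)
Let H_le_powR (r : R) : 0 < r ->
  H r <= (\sum_j \sum_i t j i * `|alpha j * alpha i|) * r `^ (- (1 - a)).
Proof.
move=> r0.
have -> : H r = \sum_j \sum_i ((t j i + r) `^ a - r `^ a) * (alpha j * alpha i).
  rewrite [RHS](_ : _ = H r - r `^ a * ((\sum_j alpha j) * \sum_i alpha i)).
    by rewrite alpha0 mul0r mulr0 subr0.
  rewrite big_distrlr/= mulr_sumr -sumrB; apply: eq_bigr => j _.
  rewrite mulr_sumr -sumrB; apply: eq_bigr => i _; ring.
rewrite mulr_suml; apply: ler_sum => j _; rewrite mulr_suml; apply: ler_sum => i _.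
have rt : 0 <= 1 + t j i / r by rewrite addr_ge0// divr_ge0// ltW.
have e : (t j i + r) `^ a = r `^ a * (1 + t j i / r) `^ a.
  by rewrite -powRM ?(ltW r0)//; congr (_ `^ _); field; rewrite gt_eqF.
have lo : 1 <= (1 + t j i / r) `^ a.
  rewrite -[leLHS](powRr0 (1 + t j i / r)); apply: ler_powR (ltW a0).
  by rewrite lerDl divr_ge0// ltW.
have up : (1 + t j i / r) `^ a <= 1 + t j i / r.
  by rewrite ler1_powR ?(ltW a1)// lerDl divr_ge0// ltW.
rewrite (le_trans (ler_norm _))// normrM mulrAC ler_wpM2r//.
rewrite e -[X in _ - X]mulr1 -mulrBr ger0_norm ?mulr_ge0 ?powR_ge0 ?subr_ge0//.
have -> : r `^ (- (1 - a)) = r `^ a / r.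
  by rewrite opprB powRB ?powRr1 ?(ltW r0)// (lt0r_neq0 r0) implybT.
rewrite [leRHS]mulrCA ler_wpM2l ?powR_ge0//; lra.
Qed.

(** [H 1 <= H r] for [r >= 1], and the bound on [H r] tends to [0] as [r] grows. *)
Let H1_le0 : H 1 <= 0.
Proof.
set C := \sum_j \sum_i t j i * `|alpha j * alpha i|.
have C0 : 0 <= C.
  by apply: sumr_ge0 => j _; apply: sumr_ge0 => i _; rewrite mulr_ge0.
apply/ler_addgt0Pr => e e0; rewrite add0r.
(* The choice [r^(1 - a) = 1 + 1 / d] ensures [r >= 1] and turns the bound into
   [C d / (d + 1) = (e - d) / (d + 1) <= e]. *)
pose d := e / (C + 1).
have d0 : 0 < d by rewrite divr_gt0// ltr_wpDl.
pose r := (1 + d^-1) `^ (1 - a)^-1.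
have r1 : 1 <= r.
  rewrite /r -[leLHS](powRr0 (1 + d^-1)) ler_powR//.
    by rewrite lerDl invr_ge0 ltW.
  by rewrite invr_ge0 subr_ge0 ltW.
have r0 : 0 < r by rewrite (lt_le_trans _ r1).
apply: le_trans (H_le ltr01 r1) _; apply: le_trans (H_le_powR r0) _.
rewrite powRN /r -powRrM mulVf ?subr_eq0 ?gt_eqF//.
rewrite powRr1 ?addr_ge0 ?invr_ge0 ?(ltW d0)//.
have -> : (1 + d^-1)^-1 = d / (d + 1) by field; rewrite !gt_eqF ?addr_gt0.
rewrite -/C mulrA ler_pdivrMr ?addr_gt0//.
have -> : C * d = e - d by rewrite /d; field; rewrite gt_eqF// ltr_wpDl.
by rewrite mulrDr mulr1; nra.
Qed.

(** A single [c] suffices for the equality case: if [H 0 = 0], then [dH c = H 1 <= 0], which with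
    [0 <= dH c] makes the shifted form at [c] vanish. *)
Let H0_MVT : exists2 c, 0 < c & H 1 - H 0 = dH c.
Proof.
have [y||c] := @MVT _ H dH 0 1 ltr01.
- by rewrite in_itv/= => /andP[y0 _]; exact: is_derive_H.
- apply/continuous_within_itvP => //; split => [y|//|].
  + rewrite in_itv/= => /andP[y0 _]; apply/differentiable_continuous/derivable1_diffP.
    by apply: ex_derive; exact: is_derive_H.
  + apply: cvg_at_left_filter; apply/differentiable_continuous/derivable1_diffP.
    by apply: ex_derive; exact: is_derive_H.
- by rewrite subr0 mulr1 in_itv/= => /andP[c0 _] e; exists c.
Qed.

Lemma distance_power_le0 :
  \sum_j \sum_i t j i `^ a * alpha j * alpha i <= 0.
Proof.
have [c c0 e] := H0_MVT.
have := shifted_kernel_ge0 b01 c0 => Q0.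
have : 0 <= dH c by rewrite mulr_ge0 ?(ltW a0).
rewrite -e subr_ge0 => /le_trans/(_ H1_le0).
by rewrite /H; under eq_bigr do under eq_bigr do rewrite addr0.
Qed.

Lemma distance_power_eq0 i0 :
  \sum_j \sum_i t j i `^ a * alpha j * alpha i = 0 ->
  \sum_(i | fiber i0 i) alpha i = 0.
Proof.
move=> H00; have [c c0 e] := H0_MVT.
apply: (@shifted_kernel_eq0 (1 - a) c) => //.
apply/eqP; rewrite eq_le shifted_kernel_ge0// andbT.
rewrite -(ler_pM2l a0) mulr0 -/(dH c) -e.
rewrite [H 0](_ : _ = 0) ?subr0//.
by rewrite -[RHS]H00 /H; under eq_bigr do under eq_bigr do rewrite addr0.
Qed.

End negative.
End shifted_kernel.

(** * Scalar-valued points *)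

Lemma normc_ge_Im (R : rcfType) (x : R[i]) : (`|complex.Im x|%:C <= `|x|)%C.
Proof.
by rewrite normc_def lecR -sqrtr_sqr ler_wsqrtr// lerDr sqr_ge0.
Qed.

Section scalars.
Context {R : realType} {F : scalar_field}.
Implicit Types x y : scalars R F.

(** Both scalar fields are viewed in the plane, a real scalar having second coordinate [0], so that
    one argument covers both. *)
Definition coord (z : scalars R F) (c : 'I_2) : R :=
  match F return scalars R F -> R with
  | RealField => fun z => if c == 0 then z else 0
  | ComplexField => fun z => if c == 0 then complex.Re z else complex.Im z
  end z.

Lemma coordB x y c : coord (x - y) c = coord x c - coord y c.
Proof.
rewrite /coord; case: F x y => /= x y; first by case: ifP; rewrite ?subr0.
by case: x y => [a b] [a' b'] /=; case: ifP.
Qed.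

Lemma coord_inj x y : (forall c, coord x c = coord y c) -> x = y.
Proof.
rewrite /coord; case: F x y => /= x y h; first exact: (h ord0).
case: x y h => [a b] [a' b'] h.
by have /= -> := h ord0; have /= -> := h ord_max.
Qed.

Lemma modulusE x : modulus x = Num.sqrt (\sum_c coord x c ^+ 2).
Proof.
rewrite big_ord_recl big_ord1 /coord /modulus; case: F x => /= x.
  by rewrite expr0n addr0 sqrtr_sqr.
by case: x.
Qed.

Lemma modulus_ge0 x : 0 <= modulus x.
Proof. by rewrite modulusE sqrtr_ge0. Qed.

Lemma le_modulusB x y : modulus (x - y) <= modulus x + modulus y.
Proof.
rewrite /modulus; case: F x y => /= x y; first exact: ler_normB.
by rewrite -(normcN y) le_normcD.
Qed.

Lemma powR_modulus x p : modulus x `^ p = (\sum_c coord x c ^+ 2) `^ (p / 2).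
Proof.
rewrite modulusE -powR12_sqrt ?sumr_ge0// => [|c _]; last exact: sqr_ge0.
by rewrite -powRrM mulrC.
Qed.

(** Complex coordinates are 1-Lipschitz for the modulus; the second coordinate of a real scalar is
    constant, so its preimages are empty or everything. *)
Lemma open_preimage_coord c (A : set R) : open A -> open ((coord ^~ c) @^-1` A).
Proof.
rewrite /coord; case: F => /= oA.
  case: (c == 0) => //.
  have [A0|A0] := pselect (A 0).
    have -> : (fun=> 0 : R) @^-1` A = [set: R] by apply/seteqP; split.
    exact: openT.
  have -> : (fun=> 0 : R) @^-1` A = set0 :> set R by apply/seteqP; split.
  exact: open0.
rewrite openE => z Az; have /nbhs_ballP[e /= e0 ballA] := oA _ Az.
apply/nbhs_ballP; exists (e%:C)%C => /=; first by rewrite ltcR.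
move=> w; rewrite -ball_normE /= => zw; apply: ballA; rewrite -ball_normE /=.
rewrite -ltcR; apply: le_lt_trans zw.
case: (c == 0); case: z w {Az} => [a b] [a' b'] /=.
  by have := normc_ge_Re ((a +i* b) - (a' +i* b'))%C.
by have := normc_ge_Im ((a +i* b) - (a' +i* b'))%C.
Qed.

End scalars.

Section scalar_kernel.
Context {R : realType} {F : scalar_field} {n : nat}.
Variables (z : 'I_n -> scalars R F) (alpha : 'I_n -> R) (p : R).
Hypotheses (p0 : 0 < p) (p2 : p < 2) (alpha0 : \sum_i alpha i = 0).

Let Q := \sum_j \sum_i modulus (z j - z i) `^ p * alpha j * alpha i.

Let QE : Q = \sum_j \sum_i
  (\sum_c (coord (z j) c - coord (z i) c) ^+ 2) `^ (p / 2) * alpha j * alpha i.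
Proof.
apply: eq_bigr => j _; apply: eq_bigr => i _; rewrite powR_modulus.
by under eq_bigr do rewrite coordB.
Qed.

Let p20 : 0 < p / 2. Proof. by rewrite divr_gt0. Qed.
Let p21 : p / 2 < 1. Proof. by rewrite ltr_pdivrMr// mul1r. Qed.

Lemma scalar_kernel_le0 : Q <= 0.
Proof. by rewrite QE (distance_power_le0 (fun i => coord (z i))). Qed.

Lemma scalar_kernel_eq0 : Q = 0 -> forall c, \sum_(i | z i == c) alpha i = 0.
Proof.
rewrite QE => /(distance_power_eq0 p20 p21 alpha0) h c.
have [[i0 /eqP <-]|hc] := pselect (exists i0, z i0 == c).
  rewrite -[RHS](h i0); apply: eq_bigl => i.
  apply/eqP/forallP => [-> //|zE]; apply: coord_inj => c'; exact/eqP/zE.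
by rewrite big_pred0// => i; apply/negbTE/negP => zc; apply: hc; exists i.
Qed.

End scalar_kernel.

(** Grouping the indices by the value of [z] makes [phi] constant on each group. *)
Lemma sum_fiber0 (R : nzRingType) (X : eqType) (n : nat) (z : 'I_n -> X)
    (alpha : 'I_n -> R) (phi : X -> R) :
  (forall c, \sum_(i | z i == c) alpha i = 0) ->
  \sum_i phi (z i) * alpha i = 0.
Proof.
move=> h; pose s := undup (codom z).
transitivity (\sum_(c <- s) \sum_(i | z i == c) phi (z i) * alpha i); last first.
  rewrite big1 // => c _.
  rewrite (eq_bigr (fun i => phi c * alpha i)) => [|i /eqP -> //].
  by rewrite -mulr_sumr h mulr0.
rewrite (exchange_big_dep xpredT)//=; apply: eq_bigr => i _.
rewrite (eq_bigl (pred1 (z i))) => [|c]; last by rewrite eq_sym.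
rewrite -big_filter filter_pred1_uniq ?undup_uniq ?mem_undup ?codom_f//.
by rewrite big_seq1.
Qed.

(** Regroups the weights of possibly repeated points [x j] over distinct points [z i]. The predicate
    [P] lets the same regrouping serve for the values of classes at a point [w]. *)
Lemma sum_refine (R : nmodType) (X : eqType) (J : finType) (n : nat)
    (z : 'I_n -> X) (x : J -> X) (w : J -> R) (P : pred X) :
  injective z -> (forall j, exists i, z i = x j) ->
  \sum_(i | P (z i)) \sum_(j | x j == z i) w j = \sum_(j | P (x j)) w j.
Proof.
move=> zi zx; rewrite (exchange_big_dep (fun j => P (x j)))/=.
  apply: eq_bigr => j Pj; have [i0 e] := zx j.
  rewrite (big_pred1 i0)// => i; rewrite -e (inj_eq zi) /= eq_sym andbC.
  by case: eqP => //= ->; rewrite e Pj.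
by move=> i j Pi /eqP ->.
Qed.

(** * Integration of the scalar forms *)

Section integration.
Context {R : realType} {F : scalar_field} {d : measure_display}.
Context {T : measurableType d} (mu : {measure set T -> \bar R}) (p : R).
Hypothesis p0 : 0 < p.
Implicit Types f g : ae_class F mu.

Lemma measurable_coord_ev f c : measurable_fun [set: T] (fun w => coord (ev f w) c).
Proof.
apply: (measurability _ (RGenOpens.measurableE R)).
move=> _ [_ [a [b ->] <-]]; rewrite setTI.
rewrite (_ : _ @^-1` _ = ev f @^-1` ((coord ^~ c) @^-1` `]a, b[%classic))//.
rewrite -[X in measurable X]setTI.
apply: (measurable_funPT (repr f)) => //; apply: sub_sigma_algebra.
exact/open_preimage_coord/interval_open.
Qed.

Lemma measurable_powR_modulusB f g :
  measurable_fun [set: T] (fun w => modulus (ev f w - ev g w) `^ p).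
Proof.
under eq_fun do rewrite powR_modulus.
apply: (@measurableT_comp _ _ _ _ _ _ (@powR R ^~ (p / 2))) => //.
apply: measurable_sum => c; apply: measurable_funX.
under eq_fun do rewrite coordB.
by apply: measurable_funB; exact: measurable_coord_ev.
Qed.

Lemma measurable_powR_modulus f :
  measurable_fun [set: T] (fun w => modulus (ev f w) `^ p).
Proof.
under eq_fun do rewrite powR_modulus.
apply: (@measurableT_comp _ _ _ _ _ _ (@powR R ^~ (p / 2))) => //.
by apply: measurable_sum => c; apply: measurable_funX; exact: measurable_coord_ev.
Qed.

Lemma integrable_powR_modulus f : Lp p f ->
  mu.-integrable setT (EFin \o (fun w => modulus (ev f w) `^ p)).
Proof.
rewrite /Lp /= /finite_norm => /(@poweR_lty _ _ p).
rewrite powR_Lnorm ?gt_eqF// => h; apply/integrableP; split.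
  exact/measurable_EFinP/measurable_powR_modulus.
apply: le_lt_trans h; rewrite le_eqVlt; apply/orP; left; apply/eqP.
apply: eq_integral => w _ /=.
by rewrite !ger0_norm ?powR_ge0 ?modulus_ge0.
Qed.

Lemma integrable_powR_modulusB f g : Lp p f -> Lp p g ->
  mu.-integrable setT (EFin \o (fun w => modulus (ev f w - ev g w) `^ p)).
Proof.
move=> /integrable_powR_modulus If /integrable_powR_modulus Ig.
have I := integrableZl measurableT (2 `^ p) (integrableD measurableT If Ig).
apply: le_integrable I => //; first exact/measurable_EFinP/measurable_powR_modulusB.
move=> w _ /=; rewrite lee_fin !ger0_norm ?mulr_ge0 ?addr_ge0 ?powR_ge0//.
(* Bounding by twice the larger modulus gives [|f - g|^p <= 2^p (|f|^p + |g|^p)] for every [p > 0],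
   including [p < 1]. *)
pose M := Num.max (modulus (ev f w)) (modulus (ev g w)).
have M0 : 0 <= M by rewrite le_max modulus_ge0.
apply: (@le_trans _ _ ((2 * M) `^ p)).
  apply: ge0_ler_powR; rewrite ?nnegrE ?(ltW p0) ?modulus_ge0 ?mulr_ge0//.
  apply: le_trans (le_modulusB _ _) _.
  by rewrite mulr_natl mulr2n lerD// le_max lexx ?orbT.
rewrite powRM// ler_wpM2l ?powR_ge0// /M.
case: (leP (modulus (ev f w)) (modulus (ev g w))) => _;
  by rewrite (lerDl, lerDr) powR_ge0.
Qed.

Lemma Lp_dist_powR f g : Lp p f -> Lp p g ->
  Lp_dist p f g `^ p = \int[mu]_w (modulus (ev f w - ev g w) `^ p).
Proof.
move=> Lf Lg; rewrite /Lp_dist -fine_poweR powR_Lnorm ?gt_eqF// /Rintegral.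
by congr fine; apply: eq_integral => w _ /=; rewrite ger0_norm ?modulus_ge0.
Qed.

Section sums.
Context {n : nat}.
Variables (z : 'I_n -> ae_class F mu) (alpha : 'I_n -> R).
Hypothesis Lz : forall i, Lp p (z i).

Let q w := \sum_j \sum_i
  modulus (ev (z j) w - ev (z i) w) `^ p * alpha j * alpha i.

Let integrable_term j i : mu.-integrable setT
  (EFin \o fun w => modulus (ev (z j) w - ev (z i) w) `^ p * alpha j * alpha i).
Proof.
have := integrableZl measurableT (alpha j * alpha i)
  (integrable_powR_modulusB (Lz j) (Lz i)).
by congr integrable; apply/funext => w /=; rewrite -EFinM; congr EFin; ring.
Qed.

Let q_EFin : EFin \o q = fun w => (\sum_j \sum_i
  (modulus (ev (z j) w - ev (z i) w) `^ p * alpha j * alpha i)%:E)%E.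
Proof.
apply/funext => w; rewrite /= /q -sumEFin; apply: eq_bigr => j _.
by rewrite -sumEFin.
Qed.

Lemma integrable_quadratic_form : mu.-integrable setT (EFin \o q).
Proof.
rewrite q_EFin; apply: integrable_sum => // j _; apply: integrable_sum => // i _.
exact: integrable_term.
Qed.

Lemma Lp_dist_quadratic_form :
  (\sum_j \sum_i Lp_dist p (z j) (z i) `^ p * alpha j * alpha i)%:E =
  (\int[mu]_w (q w)%:E)%E.
Proof.
rewrite (_ : (fun w => (q w)%:E) = EFin \o q)// q_EFin integral_sum//; last first.
  by move=> j; apply: integrable_sum => // i _; exact: integrable_term.
rewrite -sumEFin; apply: eq_bigr => j _; rewrite integral_sum//; last first.
  by move=> i; exact: integrable_term.
rewrite -sumEFin; apply: eq_bigr => i _.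
rewrite Lp_dist_powR// -mulrA EFinM.
have I := integrable_powR_modulusB (Lz j) (Lz i).
rewrite /Rintegral fineK ?integrable_fin_num// -integralZr//.
by apply: eq_integral => w _; rewrite -EFinM mulrA.
Qed.

End sums.
End integration.

(** * Virtually degenerate simplices and strict negative type *)

Section simplices.
Context {R : realType} {F : scalar_field} {d : measure_display}.
Context {T : measurableType d} (mu : {measure set T -> \bar R}) (p : R).
Hypotheses (p0 : 0 < p) (p2 : p < 2).

Section family.
Context {n : nat}.
Variables (z : 'I_n -> ae_class F mu) (alpha : 'I_n -> R).
Hypotheses (Lz : forall i, Lp p (z i)) (alpha0 : \sum_i alpha i = 0).

Let Q := \sum_j \sum_i Lp_dist p (z j) (z i) `^ p * alpha j * alpha i.

Let q w := \sum_j \sum_i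
  modulus (ev (z j) w - ev (z i) w) `^ p * alpha j * alpha i.

(** The scalar forms are nonpositive, so [q = - |q|]; the vanishing of [Q] becomes that of the
    integral of [|q|], hence of [q] almost everywhere. *)
Let QE : Q%:E = (- \int[mu]_w `|(q w)%:E|)%E.
Proof.
rewrite /Q Lp_dist_quadratic_form// -integral_ge0N; last first.
  by move=> w _; exact: abse_ge0.
apply: eq_integral => w _; rewrite abse_EFin -EFinN ler0_norm ?opprK//.
exact: scalar_kernel_le0.
Qed.

Lemma Lp_dist_form_le0 : Q <= 0.
Proof.
by rewrite -lee_fin QE leeNl oppe0 integral_ge0// => w _; exact: abse_ge0.
Qed.

Lemma Lp_dist_form_eq0 : Q = 0 <->
  {ae mu, forall w, forall c, \sum_(i | ev (z i) w == c) alpha i = 0}.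
Proof.
have mq : measurable_fun [set: T] (EFin \o q).
  exact: measurable_int (integrable_quadratic_form p0 alpha Lz).
have Q0E : Q = 0 <-> (\int[mu]_w `|(EFin \o q) w| = 0)%E.
  split=> [Q0|q0].
    by have /esym/eqP := QE; rewrite Q0 oppe_eq0 => /eqP.
  by have := QE; rewrite q0 oppe0 => -[].
have := ae_eq_integral_abs mu measurableT mq.
rewrite /ae_eq /= => qE; split => [/Q0E/qE|h].
  apply: filterS => w /(_ I) [qw0] c.
  exact: (scalar_kernel_eq0 p0 p2 alpha0 qw0).
apply/Q0E/qE.
apply: filterS h => w h _ /=; congr EFin.
(* For fixed [i] the sum over [j] weights a function of the value of [z j] at [w], and the weights
   attached to each value add up to [0]. *)
rewrite /q exchange_big/= (eq_bigr (fun i =>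
  (\sum_j modulus (ev (z j) w - ev (z i) w) `^ p * alpha j) * alpha i)).
  rewrite big1 // => i _.
  by rewrite (sum_fiber0 (fun x => modulus (x - _) `^ p) h) mul0r.
by move=> i _; rewrite mulr_suml.
Qed.

End family.

(** Away from the points of [D] both masses are empty sums. *)
Lemma degenerateE (X : eqType) (D : signed_simplex R X) :
  degenerate D <-> forall c, xmass D c = ymass D c.
Proof.
split=> [h c|h c _]; last exact: h.
have [/h //|hc] := pselect (simplex_points D c).
rewrite /xmass /ymass !big_pred0// => i; apply/negbTE/negP => /eqP e; apply: hc.
  by right; exists i.
by left; exists i.
Qed.

Lemma strict_not_admits (Z : set (ae_class F mu)) :
  Z `<=` Lp p -> strict_negative_type (Lp_dist p) p Z ->
  ~ admits_virtually_degenerate Z.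
Proof.
move=> ZL [_ strictZ] [D [DZ [ndeg vdeg]]].
(* [s] lists the distinct points of [D]; each will receive the difference of its two masses as
   weight. *)
pose s := undup (codom (xpt D) ++ codom (ypt D)).
pose z i := tnth (in_tuple s) i.
have zi : injective z by apply/tuple_uniqP; rewrite undup_uniq.
have zP f : f \in s -> exists i, z i = f.
  by move=> fs; have /tnthP[i ->] : f \in in_tuple s by []; exists i.
have zx j : exists i, z i = xpt D j.
  by apply: zP; rewrite mem_undup mem_cat codom_f.
have zy j : exists i, z i = ypt D j.
  by apply: zP; rewrite mem_undup mem_cat codom_f orbT.
have zD i : simplex_points D (z i).
  have := mem_tnth i (in_tuple s); rewrite -/(z i) mem_undup mem_cat.
  by case/orP => /codomP[j ->]; [left|right]; exists j.
pose alpha i := xmass D (z i) - ymass D (z i).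
(* With [P] total this yields the balance of [alpha]; with [P f] stating [ev f w == c] it yields the
   difference of the masses of [D(w)] at [c]. *)
have alphaE (P : pred (ae_class F mu)) : \sum_(i | P (z i)) alpha i =
    \sum_(j | P (xpt D j)) xwt D j - \sum_(i | P (ypt D i)) ywt D i.
  by rewrite sumrB !sum_refine.
have alpha0 : \sum_i alpha i = 0.
  by rewrite (alphaE xpredT) (balanced D) subrr.
have nalpha : ~ forall i, alpha i = 0.
  move=> h; apply: ndeg => f; rewrite /simplex_points.
  move=> Df; have [i <-] : exists i, z i = f by case: Df => -[j _ <-].
  by apply/eqP; rewrite -subr_eq0; apply/eqP/h.
have := strictZ _ z alpha zi (fun i => DZ _ (zD i)) alpha0 nalpha.
suff -> : \sum_j \sum_i Lp_dist p (z j) (z i) `^ p * alpha j * alpha i = 0.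
  by rewrite ltxx.
apply/(Lp_dist_form_eq0 (fun i => ZL _ (DZ _ (zD i))) alpha0).
apply: filterS vdeg => w /degenerateE h c.
rewrite (alphaE (fun f => ev f w == c)).
by apply/eqP; rewrite subr_eq0; apply/eqP/h.
Qed.

Lemma not_admits_strict (Z : set (ae_class F mu)) :
  Z `<=` Lp p -> ~ admits_virtually_degenerate Z ->
  strict_negative_type (Lp_dist p) p Z.
Proof.
move=> ZL nadm.
have le0 n (z : 'I_n -> ae_class F mu) (alpha : 'I_n -> R) :
    (forall i, Z (z i)) -> \sum_(i < n) alpha i = 0 ->
    \sum_(j < n) \sum_(i < n) Lp_dist p (z j) (z i) `^ p * alpha j * alpha i <= 0.
  by move=> zZ; apply: Lp_dist_form_le0 => i; exact/ZL/zZ.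
split=> [n z alpha _ zZ alpha0|n z alpha zi zZ alpha0 nalpha]; first exact: le0.
rewrite lt_neqAle le0// andbT; apply/eqP => Q0; apply: nadm.
have n0 : (0 < n)%N.
  rewrite lt0n; apply/eqP => n0; apply: nalpha => i.
  by have := ltn_ord i; rewrite {2}n0.
(* All points go to the first side with weights [alpha]. The second side must be non-empty and
   receives one point of the family with weight [0], so that every [ymass] is [0]. *)
have bal : \sum_j alpha j = \sum_(i < 1) (fun=> 0 : R) i by rewrite alpha0 big1.
exists (SignedSimplex n0 (isT : 0 < 1)%N z (fun=> z (Ordinal n0)) bal).
split; first by move=> f [] [i _ <-]; exact: zZ.
split.
  move=> /degenerateE deg; apply: nalpha => i.
  have := deg (z i); rewrite /xmass /ymass /= (big_pred1 i) => [->|k /=].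
    by rewrite big1.
  by rewrite (inj_eq zi).
have /(Lp_dist_form_eq0 (fun i => ZL _ (zZ i)) alpha0) := Q0.
by apply: filterS => w h; apply/degenerateE => c; rewrite /xmass /ymass /= h big1.
Qed.

End simplices.

Theorem corollary4p9 (R : realType) (F : scalar_field) (d : measure_display)
    (T : measurableType d) (mu : {measure set T -> \bar R}) (p : R)
    (Z : set (ae_class F mu)) :
  0 < p -> p < 2 ->
  mu [set: T] <> 0%E ->
  Lp_at_least_two_dimensional F mu p ->
  Z !=set0 -> Z `<=` Lp p ->
  strict_negative_type (Lp_dist p) p Z <->
  ~ admits_virtually_degenerate Z.
Proof.
move=> p0 p2 _ _ _ ZL; split; first exact: strict_not_admits.
exact: not_admits_strict.
Qed.
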